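(* Let $\mathcal{A}$ be a finite alphabet, $\mathcal{F}\subset\mathcal{A}^*$ a set of forbidden words, $X=X(\mathcal{A},\mathcal{F})$ the induced subshift, and let $G\subset\mathcal{L}(X)$ be the set of all words in $\mathcal{L}(X)$ which have no heavy subword as a prefix and no heavy subword as a suffix. If there exists $c > |\mathcal{A}|^{-1}$ so that \[ \sum_{n = 1}^{\infty} |\mathcal{F}_n| c^n < \frac{|\mathcal{A}| c - 1}{2}\quad\text{and}\quad \sum_{n = 1}^{\infty} n |\mathcal{F}_n| c^{n/3} < \frac14, \] then for any $v,w \in G$, $vw \in \mathcal{L}(X)$.
   Context: $\mathcal{A}^*$ is the set of finite (nonempty) words over $\mathcal{A}$, and $\mathcal{F}_n$ is the set of words in $\mathcal{F}$ of length $n$ ($\mathcal{F}$ may be infinite). $X(\mathcal{A},\mathcal{F})$ is the set of all $x\in\mathcal{A}^{\mathbb{Z}}$ that contain no word from $\mathcal{F}$ as a (contiguous) subword. $\mathcal{L}(X)$ is the set of all finite words appearing in points of $X$. Subwords, prefixes and suffixes of a word are allowed to equal the whole word. A heavy subword is a (contiguous) subword of some $u\in\mathcal{F}$ whose length is at least $|u|/3$, where $|u|$ is the length of $u$. $vw$ denotes concatenation. *)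

(* Defs.v *)
From HB Require Import structures.
From mathcomp Require Import all_boot all_order all_algebra.
From mathcomp Require Import all_classical all_reals all_analysis.

Set Implicit Arguments.
Unset Strict Implicit.
Unset Printing Implicit Defensive.

Import Order.TTheory GRing.Theory Num.Theory.

Local Open Scope classical_set_scope.
Local Open Scope ring_scope.

(* The set A^* of finite words is, by convention, without the empty word. *)
Definition words (A : finType) : set (seq A) := [set w | w <> [::]].

Definition appears (A : finType) (w : seq A) (x : int -> A) : Prop :=
  exists i : int, mkseq (fun k => x (i + k%:Z)) (size w) = w.

Definition subshift (A : finType) (F : set (seq A)) : set (int -> A) :=
  [set x | forall u, F u -> ~ appears u x].

Definition language (A : finType) (X : set (int -> A)) : set (seq A) :=
  [set w | words w /\ exists2 x, X x & appears w x].

(* [infix h u] says that h is a contiguous subword of u, possibly u itself;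
   the length condition is |h| >= |u| / 3 with the denominator cleared. *)
Definition heavy (A : finType) (F : set (seq A)) : set (seq A) :=
  [set h | exists u, [/\ F u, infix h u & (size u <= 3 * size h)%N]].

Definition good_words (A : finType) (F : set (seq A)) : set (seq A) :=
  [set w | language (subshift F) w /\
           forall h, heavy F h -> ~~ prefix h w /\ ~~ suffix h w].

Definition num_words (A : finType) (F : set (seq A)) (n : nat) : nat :=
  #|[pred t : n.-tuple A | tval t \in F]|.

(* Main.v *)
Require Import Defs.
From HB Require Import structures.
From mathcomp Require Import all_boot all_order all_algebra.
From mathcomp Require Import all_classical all_reals all_analysis.
From mathcomp Require Import zify ring lra.

Set Implicit Arguments.
Unset Strict Implicit.
Unset Printing Implicit Defensive.

Import Order.TTheory GRing.Theory Num.Theory.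

Local Open Scope classical_set_scope.

(** Write W n for the number of words of length n that contain no forbidden
    word, f k for the number of forbidden words of length k, and m = v w.

    By compactness it suffices to extend m by n letters on each side, for
    every n, without creating a forbidden word
    ([language_of_extensions]).  Only pairs (s, t) of words that are
    themselves free of forbidden words are tried; there are (W n)^2 of them,
    and the point is that fewer than (W n)^2 can fail.

    A forbidden word u inside s m t must overlap both m and s t in a
    restricted way.  Whatever part of u lies in v is a prefix or a suffix of
    v, or u would lie inside v; as v has no heavy prefix or suffix, this part
    is shorter than |u|/3, and likewise for w.  So u has i letters at the end
    of s and j letters at the start of t with i + j > |u|/3
    ([good_words_seam], [infix_overlap]).  For each length k there are at
    most 2 k possible pairs (i, j): either i > 0, and then i determines j, or
    i = 0.  Once u and (i, j) are fixed, s and t are known up to words of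
    length n - i and n - j, so at most
    sum_k sum_(i, j) W (n - i) * f k * W (n - j) pairs fail
    ([inadmissible_pairs_count]).

    Finally W n <= c * W (n + 1) ([admissible_words_growth]): appending a
    letter to a free word fails only if a forbidden word of some length k
    appears as a suffix, and the first hypothesis bounds the number of
    failures.  Hence W (n - i) * W (n - j) <= c^(i + j) * (W n)^2, where
    c^(i + j) <= c^(k / 3), and the number of failing pairs is at most
    (W n)^2 * sum_k 2 * k * f k * c^(k / 3) < (W n)^2 / 2. *)

(** * Factorisations of words *)

Lemma cat_eq_cat (T : Type) (x y z t : seq T) : x ++ y = z ++ t ->
  (exists e, x = z ++ e /\ t = e ++ y) \/ (exists e, z = x ++ e /\ y = e ++ t).
Proof.
elim: x z => [|a x IH] [|b z] /=.
- by move=> ->; left; exists [::].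
- by move=> ->; right; exists (b :: z).
- by move=> <-; left; exists (a :: x).
- by case=> -> /IH [] [e [-> ->]]; [left|right]; exists e.
Qed.

Definition admissible (A : finType) (F : set (seq A)) : set (seq A) :=
  [set w | forall u, F u -> ~~ infix u w].

Lemma admissible_infix (A : finType) (F : set (seq A)) (v w : seq A) :
  infix v w -> admissible F w -> admissible F v.
Proof.
by move=> vw Fw u Fu; apply: contra (Fw _ Fu) => uv; apply: infix_trans uv vw.
Qed.

Lemma not_admissibleP (A : finType) (F : set (seq A)) (w : seq A) :
  ~ admissible F w -> exists2 u, F u & infix u w.
Proof.
move=> nFw; apply: contrapT => nex; apply: nFw => u Fu.
by apply/negP => uw; apply: nex; exists u.
Qed.

Lemma language_admissible (A : finType) (F : set (seq A)) (w : seq A) :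
  language (subshift F) w -> admissible F w.
Proof.
move=> [_ [x Xx [i xw]]] u Fu; apply/negP => /infixP[p [q wE]].
apply: (Xx u Fu); exists (i + (size p)%:Z)%R.
pose a := x 0%R.
apply: (@eq_from_nth _ a); first by rewrite size_mkseq.
move=> k; rewrite size_mkseq => ku; rewrite nth_mkseq //.
have := congr1 (fun s => nth a s (size p + k)) xw.
rewrite /= nth_mkseq; last by rewrite wE !size_cat; lia.
rewrite wE nth_cat ltnNge leq_addr /= addnC addnK nth_cat ku => <-.
by congr (x _); lia.
Qed.

(** What the combination of v and w has to satisfy for the extension argument:
    a forbidden word p r q that meets m in r, sticking out on the left by p
    and on the right by q, sticks out by at least a third of its length.
    Taking p and q empty, no forbidden word lies inside m. *)
Definition seam (A : finType) (F : set (seq A)) (m : seq A) : Prop :=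
  forall u p r q, F u -> u = p ++ r ++ q -> infix r m ->
    (p <> [::] -> prefix r m) -> (q <> [::] -> suffix r m) ->
    size u <= 3 * (size p + size q).

(** The part r of a forbidden word u that falls in v w splits into a part in v
    and a part in w, each shorter than a third of u since it is a
    prefix or suffix of v or w; so r covers less than two thirds of u. *)
Lemma good_words_seam (A : finType) (F : set (seq A)) (v w : seq A) :
  F `<=` @words A -> good_words F v -> good_words F w -> seam F (v ++ w).
Proof.
move=> hF [Lv Gv] [Lw Gw] u p r q Fu uE rm hp hq.
have ru (h : seq A) : infix h r -> infix h u.
  by move=> /infixP[x [y rE]]; apply/infixP; exists (p ++ x), (y ++ q);
    rewrite uE rE -!catA.
have light (h : seq A) : infix h r ->
    [|| prefix h v, suffix h v, prefix h w | suffix h w] ->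
    3 * size h < size u.
  move=> /ru hu; case: (ltnP (3 * size h) (size u)) => // uh.
  have Hh : heavy F h by exists u.
  have [/negPf-> /negPf->] := Gv h Hh; have [/negPf-> /negPf->] := Gw h Hh; by [].
have usz : size u = size p + size r + size q by rewrite uE !size_cat addnA.
suff [[p0 [q0 rvw]]|ru_lt] :
    (p = [::] /\ q = [::] /\ (infix r v \/ infix r w)) \/ 3 * size r < 2 * size u.
- move: uE; rewrite p0 q0 cats0 /= => uE.
  rewrite uE in Fu.
  case: rvw => r_infix.
    by have /negP[] := language_admissible Lv Fu.
  by have /negP[] := language_admissible Lw Fu.
- by lia.
(* A prefix of v w that reaches into w contains v, which is its own prefix;
   this is how forbidden words covering v or w entirely are handled. *)
have pre : prefix r (v ++ w) -> 3 * size r < 2 * size u.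
  move=> /prefixP[b] /cat_eq_cat[[e [vE _]]|[e [rE wE]]].
    have := light r (infix_refl r); rewrite vE prefix_prefix => /(_ isT); lia.
  have := light v; rewrite rE prefix_infix prefix_refl => /(_ isT isT).
  have := light e; rewrite rE suffix_infix wE prefix_prefix !orbT => /(_ isT isT).
  by rewrite size_cat; lia.
have suf : suffix r (v ++ w) -> 3 * size r < 2 * size u.
  move=> /suffixP[b] /cat_eq_cat[[e [vE rE]]|[e [_ wE]]].
    have := light w; rewrite rE suffix_infix suffix_refl !orbT => /(_ isT isT).
    have := light e; rewrite rE prefix_infix vE suffix_suffix !orbT => /(_ isT isT).
    by rewrite size_cat; lia.
  have := light r (infix_refl r); rewrite wE suffix_suffix !orbT => /(_ isT); lia.
case: (pselect (p = [::])) => [p0|/hp/pre]; last by right.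
case: (pselect (q = [::])) => [q0|/hq/suf]; last by right.
move/infixP: rm => [a [b]] /cat_eq_cat[[e [vE /cat_eq_cat[]]]|[e [aE wE]]].
- case=> f [rE wE]; right.
  have := light f; rewrite rE suffix_infix wE prefix_prefix !orbT => /(_ isT isT).
  have := light e; rewrite rE prefix_infix vE suffix_suffix !orbT => /(_ isT isT).
  by rewrite size_cat; lia.
- case=> f [eE _]; left; split=> //; split=> //; left; apply/infixP.
  by exists a, f; rewrite vE eE.
- by left; split=> //; split=> //; right; apply/infixP; exists e, b.
Qed.

(** The possible numbers (i, j) of letters by which a forbidden word of length k
    enters the left and the right extension of a word of length l.  If i > 0
    then i fixes the position of the word, hence j, truncated subtraction
    covering the words that end before the right extension; if i = 0 then j
    fixes it. *)
Definition overlaps (l k : nat) : seq (nat * nat) :=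
  [seq (i.+1, k - i.+1 - l) | i <- iota 0 k] ++ [seq (0, j.+1) | j <- iota 0 k].

Lemma size_overlaps l k : size (overlaps l k) = 2 * k.
Proof. by rewrite size_cat !size_map !size_iota mul2n addnn. Qed.

Lemma mem_overlaps l k i j :
  (0 < i <= k /\ j = k - i - l) \/ (i = 0 /\ 0 < j <= k) -> (i, j) \in overlaps l k.
Proof.
rewrite mem_cat => -[[ik ->]|[-> jk]]; apply/orP; [left|right].
  by apply/mapP; exists i.-1; rewrite ?mem_iota ?prednK //; lia.
by apply/mapP; exists j.-1; rewrite ?mem_iota ?prednK //; lia.
Qed.

(** A forbidden word in s m t lies inside neither s nor t nor m, so it overlaps
    m or meets its ends, and the seam property bounds the overlap. *)
Lemma infix_overlap (A : finType) (F : set (seq A)) (m s t u : seq A) :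
    F `<=` @words A -> seam F m -> admissible F s -> admissible F t ->
    F u -> infix u (s ++ m ++ t) ->
  exists a p r q b, [/\ s = a ++ p, t = q ++ b, u = p ++ r ++ q,
    (size p, size q) \in overlaps (size m) (size u) &
    size u <= 3 * (size p + size q)].
Proof.
move=> hF mF Fs Ft Fu.
have u0 : 0 < size u by case: (u) (hF u Fu) => // /(_ erefl).
have num : ~ infix u m.
  move=> um; have := mF u [::] u [::] Fu; rewrite cats0 => /(_ erefl um).
  move=> h; have {h} : size u <= 0 by apply: h.
  by lia.
(* The two kinds of placement, by whether u reaches into s. *)
have right_only a r q b : s = a -> t = q ++ b -> u = r ++ q -> suffix r m ->
    exists a p r q b, [/\ s = a ++ p, t = q ++ b, u = p ++ r ++ q,
      (size p, size q) \in overlaps (size m) (size u) &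
      size u <= 3 * (size p + size q)].
  move=> -> tE uE rm; exists a, [::], r, q, b; rewrite cats0 /=; split=> //.
    apply: mem_overlaps; right; split=> //; rewrite uE size_cat leq_addl andbT.
    case: (posnP (size q)) => // /size0nil q0; case: num.
    by rewrite uE q0 cats0; apply: suffixW.
  by have := mF u [::] r q Fu uE (suffixW rm); apply.
move=> /infixP uz; have [a [b]] : exists a b : seq A, s ++ m ++ t = a ++ u ++ b := uz.
move=> /cat_eq_cat[[p [sE]]|[e [_ /cat_eq_cat[]]]].
- case/cat_eq_cat=> [[r [uE /cat_eq_cat[]]]|[f [pE _]]]; last first.
    by have /negP[] := Fs _ Fu; rewrite sE pE infix_infix.
  + case=> q [rE tE]; case: (posnP (size p)) => [/size0nil p0|p_gt0].
      apply: (@right_only s m q b) => //; first by rewrite uE p0 rE.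
      exact: suffix_refl.
    exists a, p, m, q, b; rewrite -rE; split=> //.
      apply: mem_overlaps; left; rewrite uE rE !size_cat; lia.
    apply: (mF u p m q) => //; rewrite ?uE ?rE ?infix_refl //.
      by rewrite prefix_refl.
    by rewrite suffix_refl.
  + case=> g [mE bE]; case: (posnP (size p)) => [/size0nil p0|p_gt0].
      by case: num; rewrite uE p0 mE /= prefix_infix.
    exists a, p, r, [::], t; rewrite cats0; split=> //.
      apply: mem_overlaps; left; rewrite mE uE !size_cat /=; lia.
    rewrite /= addn0.
    have := mF u p r [::] Fu; rewrite cats0 addn0; apply=> //.
      by rewrite mE prefix_infix.
    by rewrite mE prefix_prefix.
- case=> r [mE /cat_eq_cat[]]; last first.
    by case=> f [rE _]; case: num; rewrite mE rE infix_infix.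
  case=> q [uE tE]; apply: (@right_only s r q b) => //.
  by rewrite mE suffix_suffix.
- by case=> f [_ tE]; have /negP[] := Ft _ Fu; rewrite tE infix_infix.
Qed.

(** * Counting words *)

(** Lists rather than finite types of tuples, so that every bound below is an
    inclusion between a duplicate-free list and a list of concatenations. *)
Definition words_of (A : finType) (P : set (seq A)) (n : nat) : seq (seq A) :=
  [seq w <- [seq tval t | t <- enum {: n.-tuple A}] | w \in P].

Lemma mem_words_of (A : finType) (P : set (seq A)) n (w : seq A) :
  reflect (size w = n /\ P w) (w \in words_of P n).
Proof.
rewrite mem_filter; apply: (iffP andP) => [[/set_mem Pw /mapP[t _ wE]]|[wn Pw]].
  by rewrite {1}wE size_tuple.
split; first exact/mem_set.
by apply/mapP; exists (tcast wn (in_tuple w)); rewrite ?mem_enum // val_tcast.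
Qed.

Lemma words_of_uniq (A : finType) (P : set (seq A)) n : uniq (words_of P n).
Proof.
by apply/filter_uniq; rewrite map_inj_uniq ?enum_uniq // => s t /val_inj.
Qed.

Lemma size_words_of (A : finType) (P : set (seq A)) n :
  size (words_of P n) = num_words P n.
Proof.
rewrite /num_words cardE [in RHS]/enum_mem !size_filter count_map.
by rewrite -enumT; apply: eq_count => t.
Qed.

Lemma size_flatten_map (I T : Type) (r : seq I) (f : I -> seq T) :
  size (flatten [seq f i | i <- r]) = \sum_(i <- r) size (f i).
Proof. by rewrite size_flatten /shape -map_comp sumnE big_map. Qed.

(** Appending a letter to a word without forbidden subwords can only create a
    forbidden suffix; removing that suffix, of length k, leaves
    an admissible word of length n + 1 - k. *)
Lemma admissible_extension_count (A : finType) (F : set (seq A)) n :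
  F `<=` @words A ->
  #|A| * num_words (admissible F) n <=
    num_words (admissible F) n.+1 +
    \sum_(1 <= k < n.+2) num_words (admissible F) (n.+1 - k) * num_words F k.
Proof.
move=> hF; rewrite -!size_words_of mulnC cardE.
rewrite -(size_allpairs (fun w a => rcons w a)).
under eq_bigr do rewrite -!size_words_of -(size_allpairs cat).
rewrite -size_flatten_map -size_cat; move lengthsE: (index_iota 1 n.+2) => lengths.
apply: uniq_leq_size.
  apply: allpairs_uniq; rewrite ?words_of_uniq ?enum_uniq //.
  by move=> [x a] [y b] _ _ /= /rcons_inj.
move=> _ /allpairsP[[w a] /= [/mem_words_of[wn Fw] _ ->]]; rewrite mem_cat.
have [Fz|/not_admissibleP[u Fu /infixP[x [y]]]] := pselect (admissible F (rcons w a)).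
  by apply/orP; left; apply/mem_words_of; rewrite size_rcons wn.
case/lastP: y => [|y b]; last first.
  rewrite -!rcons_cat => /rcons_inj[wE _].
  by have /negP[] := Fw _ Fu; rewrite wE infix_infix.
rewrite cats0 => zE; apply/orP; right.
have u0 : 0 < size u by case: (u) (hF u Fu) => // /(_ erefl).
have szE : n.+1 = size (x : seq A) + size u by rewrite -size_cat -zE size_rcons wn.
apply/flatten_mapP; exists (size u); first by rewrite -lengthsE mem_index_iota; lia.
apply/allpairsP; exists (x, u); split=> //=; apply/mem_words_of; split=> //.
  by lia.
apply: admissible_infix Fw; apply/infixP.
case/lastP: (u) u0 zE => // u' b _; rewrite -rcons_cat => /rcons_inj[-> _].
by exists [::], u'.
Qed.

(** If no pair extends m, every pair (s, t) is determined by a forbidden word u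
    in s m t, its placement (i, j), and what is left of s and t: the part of
    s t covered by u consists of the first i and the last j letters of u. *)
Lemma inadmissible_pairs_count (A : finType) (F : set (seq A)) (m : seq A) n :
  F `<=` @words A -> seam F m ->
  (forall s t, size s = n -> size t = n -> admissible F s -> admissible F t ->
     ~ admissible F (s ++ m ++ t)) ->
  num_words (admissible F) n ^ 2 <=
    \sum_(1 <= k < (n + size m + n).+1)
      \sum_(ij <- overlaps (size m) k |
            [&& ij.1 <= n, ij.2 <= n & k <= 3 * (ij.1 + ij.2)])
        num_words (admissible F) (n - ij.1) *
        (num_words F k * num_words (admissible F) (n - ij.2)).
Proof.
move=> hF mF bad; set W := words_of (admissible F).
pose place k ij :=
  [seq x ++ y | x <- W (n - ij.1),
    y <- [seq take ij.1 u ++ drop (k - ij.2) u ++ z |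
           u <- words_of F k, z <- W (n - ij.2)]].
under eq_bigr => k _.
  under eq_bigr => ij _.
    rewrite -!size_words_of.
    rewrite -(size_allpairs (fun u z => take ij.1 u ++ drop (k - ij.2) u ++ z)).
    rewrite -(size_allpairs cat) -/(place k ij).
    over.
  rewrite -big_filter -size_flatten_map.
  over.
rewrite -size_flatten_map -mulnn -size_words_of -(size_allpairs cat).
move lengthsE: (index_iota 1 _) => lengths.
apply: uniq_leq_size.
  apply: allpairs_uniq; rewrite ?words_of_uniq //.
  move=> [s t] [s' t'] /allpairsP[[? ?] [/mem_words_of[sn _] _ [-> ->]]].
  move=> /allpairsP[[? ?] [/mem_words_of[sn' _] _ [-> ->]]] /= /eqP.
  by rewrite eqseq_cat ?sn ?sn' // => /andP[/eqP-> /eqP->].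
move=> _ /allpairsP[[s t] /= [/mem_words_of[sn Fs] /mem_words_of[tn Ft] ->]].
have {}sn : size (s : seq A) = n := sn; have {}tn : size (t : seq A) = n := tn.
have /not_admissibleP[u Fu uz] := bad s t sn tn Fs Ft.
have := infix_overlap hF mF Fs Ft Fu uz.
move=> [a [p [r [q [b [sE tE uE pq_overlap pq_long]]]]]].
have u0 : 0 < size u by case: (u) (hF u Fu) => // /(_ erefl).
have un : size u <= n + size m + n.
  have [x [y /(congr1 (@size A))]] : exists x y : seq A, s ++ m ++ t = x ++ u ++ y.
    exact/infixP.
  by rewrite !size_cat sn tn; lia.
have pn : size a + size p = n by rewrite -size_cat -sE.
have qn : size q + size b = n by rewrite -size_cat -tE.
apply/flatten_mapP; exists (size u); first by rewrite -lengthsE mem_index_iota; lia.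
apply/flatten_mapP; exists (size p, size q).
  by rewrite mem_filter pq_overlap pq_long /= andbT; lia.
have -> : s ++ t = a ++ (p ++ q ++ b) by rewrite sE tE !catA.
apply: (allpairs_f cat); first apply/mem_words_of.
  split=> /=; first by lia.
  by apply: admissible_infix Fs; rewrite sE prefix_infix.
have -> : p ++ q ++ b = take (size p) u ++ drop (size u - size q) u ++ b.
  rewrite uE take_size_cat // (_ : _ - _ = size (p ++ r)).
    by rewrite [p ++ r ++ q]catA drop_size_cat.
  by rewrite !size_cat addnA addnK.
apply/allpairsP; exists (u, b); split=> //; apply/mem_words_of; split=> //=.
  by lia.
by apply: admissible_infix Ft; rewrite tE suffix_infix.
Qed.

Local Open Scope ring_scope.

(** * Growth of the number of admissible words *)

Lemma nneseries_lt_partial (R : realType) (f : nat -> R) (M : R) :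
  (forall n, 0 <= f n) -> (\sum_(1 <= n <oo) (f n)%:E < M%:E)%E ->
  forall N, \sum_(1 <= n < N) f n < M.
Proof.
move=> f0 fM N; rewrite -lte_fin -sumEFin; apply: le_lt_trans fM.
by apply: nneseries_lim_ge => n _ _; rewrite lee_fin.
Qed.

Lemma geometric_growth_le (R : realType) (c : R) (a : nat -> R) n i :
  0 <= c -> (forall m, (m < n)%N -> a m <= c * a m.+1) -> (i <= n)%N ->
  a (n - i)%N <= c ^+ i * a n.
Proof.
move=> c0 ac; elim: i => [|i IH] ilt; first by rewrite subn0 expr0 mul1r.
apply: le_trans (ac _ _) _; first by lia.
rewrite exprS -mulrA ler_wpM2l // (_ : _.+1 = n - i)%N; last by lia.
by apply: IH; lia.
Qed.

(** By strong induction: growth at smaller lengths bounds the words lost at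
    length n + 1 because of forbidden suffixes by
    W n * sum_k f k * c^(k - 1) <= W n * (|A| - 1/c). *)
Lemma admissible_words_growth (R : realType) (A : finType) (F : set (seq A)) (c : R) :
    F `<=` @words A -> 0 < c ->
    (forall N, \sum_(1 <= n < N) ((num_words F n)%:R * c ^+ n)
                 <= #|A|%:R * c - 1) ->
  forall n, (num_words (admissible F) n)%:R
              <= c * (num_words (admissible F) n.+1)%:R.
Proof.
move=> hF c0 hc; pose a n : R := (num_words (admissible F) n)%:R.
rewrite -/(a _) => n; have [m nm] := ubnP n; elim: m n nm => // m IH n nm.
have an0 : 0 <= a n by exact: ler0n.
have pow k : (0 < k < n.+2)%N -> c * a (n.+1 - k)%N <= c ^+ k * a n.
  case: k => // k kn; rewrite subSS exprS -mulrA ler_pM2l //.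
  by apply: geometric_growth_le => [|j jn|]; [exact: ltW|apply: IH; lia|lia].
have := admissible_extension_count n hF.
rewrite -(ler_nat R) natrM natrD natr_sum -/(a n) -/(a n.+1).
move=> /(ler_wpM2l (ltW c0)); rewrite mulrDr mulr_sumr => ext.
have {pow} : \sum_(1 <= k < n.+2)
    c * (num_words (admissible F) (n.+1 - k) * num_words F k)%:R <=
    \sum_(1 <= k < n.+2) ((num_words F k)%:R * c ^+ k) * a n.
  rewrite big_nat_cond [leRHS]big_nat_cond ler_sum // => k /andP[kn _].
  rewrite natrM mulrA [leLHS]mulrC -[leRHS]mulrA ler_wpM2l //.
  exact: pow.
rewrite -mulr_suml; have := ler_wpM2r an0 (hc n.+2); rewrite mulrBl mul1r; lra.
Qed.

Lemma admissible_words_pos (R : realType) (A : finType) (F : set (seq A)) (c : R) :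
    F `<=` @words A ->
    (forall n, (num_words (admissible F) n)%:R
              <= c * (num_words (admissible F) n.+1)%:R) ->
  forall n, (0 < num_words (admissible F) n)%N.
Proof.
move=> hF growth; elim=> [|n IH].
  rewrite -size_words_of -has_predT; apply/hasP; exists [::] => //.
  apply/mem_words_of; split=> // u /hF; case: u => // /(_ erefl).
rewrite lt0n; apply/eqP => W0; have := growth n.
by rewrite W0 mulr0 lern0 -leqn0 leqNgt IH.
Qed.

(** The two-sided count: if no extension existed, the (W n)^2 pairs would all be
    among fewer than (W n)^2 bad ones. *)
Lemma exists_admissible_extension (R : realType) (A : finType) (F : set (seq A))
    (c : R) (m : seq A) :
    F `<=` @words A -> 0 < c -> seam F m ->
    (forall N, \sum_(1 <= n < N) ((num_words F n)%:R * c ^+ n)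
                 <= #|A|%:R * c - 1) ->
    (forall N, \sum_(1 <= n < N) (n%:R * (num_words F n)%:R * c `^ (n%:R / 3))
                 < 1 / 2) ->
  forall n, exists s t, [/\ size s = n, size t = n & admissible F (s ++ m ++ t)].
Proof.
move=> hF c0 mF h1 h2 n; apply: contrapT => bad.
have growth := admissible_words_growth hF c0 h1.
pose a n : R := (num_words (admissible F) n)%:R.
have an0 : 0 < a n by rewrite ltr0n; apply: admissible_words_pos growth _.
have pow i : (i <= n)%N -> a (n - i)%N <= c ^+ i * a n.
  by apply: geometric_growth_le => [|k _]; [exact: ltW|exact: growth].
have noext s t : size s = n -> size t = n -> ~ admissible F (s ++ m ++ t).
  by move=> sn tn st; apply: bad; exists s, t.
have := inadmissible_pairs_count hF mF (fun s t sn tn _ _ => noext s t sn tn).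
apply/negP; rewrite -ltnNge -(ltr_nat R) natrX -/(a n) natr_sum.
(* If c >= 1, a forbidden word of length k alone makes the second series at
   least 1; so c < 1, and powers of c decrease with the exponent. *)
have c1 k : (0 < k)%N -> (0 < num_words F k)%N -> c < 1.
  move=> k0 Fk; rewrite ltNge; apply/negP => c1.
  have := h2 k.+1; rewrite ltNge => /negP; apply.
  rewrite big_nat_recr //= ler_wpDl //.
    by apply: sumr_ge0 => i _; rewrite !mulr_ge0 ?powR_ge0.
  have : 1 <= k%:R * (num_words F k)%:R :> R by rewrite -natrM ler1n muln_gt0 k0.
  have : 1 <= c `^ (k%:R / 3).
    have k3 : 0 <= k%:R / 3 :> R by rewrite divr_ge0.
    by have := ler_powR c1 k3; rewrite powRr0.
  nra.
apply: (@le_lt_trans _ _ (\sum_(1 <= k < (n + size m + n).+1)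
   (k%:R * (num_words F k)%:R * c `^ (k%:R / 3)) * (2 * a n ^+ 2))); last first.
  rewrite -mulr_suml; have := h2 (n + size m + n).+1; have : 0 < a n ^+ 2 by rewrite exprn_gt0.
  nra.
rewrite big_nat_cond [leRHS]big_nat_cond ler_sum // => k /andP[/andP[k0 _] _].
rewrite natr_sum.
pose B : R := (num_words F k)%:R * c `^ (k%:R / 3) * a n ^+ 2.
apply: (@le_trans _ _ (\sum_(ij <- overlaps (size m) k) B)); last first.
  rewrite big_const_seq count_predT size_overlaps iter_addr_0.
  by rewrite -[leLHS]mulr_natl natrM /B le_eqVlt; apply/orP; left; apply/eqP; ring.
rewrite big_mkcond /=; apply: ler_sum => -[i j] _ /=.
have B0 : 0 <= B by rewrite /B !mulr_ge0 ?powR_ge0 // exprn_ge0 // ltW.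
case: ifP => // /and3P[ilen jlen kij]; rewrite !natrM -/(a _) -/(a (n - j)%N).
have [Fk0|Fk] := posnP (num_words F k); first by rewrite Fk0 mul0r mulr0.
have cexp : c ^+ (i + j) <= c `^ (k%:R / 3).
  rewrite -powR_mulrn ?(ltW c0) //; apply: ger_powR.
    by rewrite c0 ltW ?(c1 k).
  by rewrite ler_pdivrMr // -natrM ler_nat mulnC.
have -> : B = (num_words F k)%:R * (c `^ (k%:R / 3) * (a n * a n)).
  by rewrite /B expr2; ring.
rewrite mulrCA ler_wpM2l //.
apply: (@le_trans _ _ ((c ^+ i * a n) * (c ^+ j * a n))).
  by rewrite ler_pM // pow.
rewrite mulrACA -exprD ler_wpM2r //.
by rewrite mulr_ge0 // ltW.
Qed.

(** * Compactness *)

(** Compactness of the full shift in sequential form: an ultrafilter on the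
    indices selects a letter at each coordinate, and agreement on finitely
    many coordinates is again a large set of indices. *)
Lemma pointwise_cluster (A : finType) (I : eqType) (x : nat -> I -> A) :
  exists y : I -> A, forall (r : seq I) (N : nat),
    exists2 n, (N <= n)%N & {in r, x n =1 y}.
Proof.
have [U [Uultra oosubU]] := @ultraFilterLemma nat \oo _.
have Uproper : ProperFilter U := ultra_proper.
have pigeonhole i : exists a, U [set n | x n i = a].
  apply: contrapT => none.
  have : \forall n \near U, forall a, x n i <> a.
    apply: filter_forall => a.
    by have [Ua|] := in_ultra_setVsetC [set n | x n i = a] Uultra; first by case: none; exists a.
  by move=> /filter_ex[n /(_ (x n i))].
have [y Uy] := choice pigeonhole; exists y => r N.
suff /filter_ex[n [Nn xn]] : U [set n | (N <= n)%N /\ {in r, x n =1 y}] by exists n.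
apply: filterI; first by apply: oosubU; exact: nbhs_infty_ge.
elim: r => [|i r IH]; first by apply: filterE.
apply: filterS (filterI (Uy i) IH) => n [xi xr] j.
by rewrite inE => /predU1P[->|/xr].
Qed.

(** The extensions, centred so that m starts at the origin, cluster at a point
    in which every window is a window of arbitrarily long extensions. *)
Lemma language_of_extensions (A : finType) (F : set (seq A)) (m : seq A) :
    words m ->
    (forall n, exists s t,
       [/\ size s = n, size t = n & admissible F (s ++ m ++ t)]) ->
  language (subshift F) m.
Proof.
move=> m0 ext; have a0 : A by case: (m) m0.
have [s /choice[t st]] := choice ext.
pose z n := s n ++ m ++ t n.
(* The nth function is meaningful only on the window from - n on; the absolute
   value merely makes it total. *)
pose x n (i : int) := nth a0 (z n) (absz (i + n%:Z)).
have [y xy] := pointwise_cluster x.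
have sz n : size (z n) = (n + (size m + n))%N.
  by have [sn tn _] := st n; rewrite !size_cat sn tn.
split=> //; exists y.
  move=> u Fu [i yu].
  have [n nlarge xny] := xy [seq i + k%:Z | k <- iota 0 (size u)] (absz i + size u)%N.
  have [_ _ /(_ u Fu)/negP] := st n; apply; rewrite -/(z n).
  have -> : u = take (size u) (drop (absz (i + n%:Z)) (z n)).
    rewrite -{1}yu; apply: (@eq_from_nth _ a0).
      by rewrite size_mkseq size_takel // size_drop sz; lia.
    move=> k; rewrite size_mkseq => ku; rewrite nth_mkseq // nth_take // nth_drop.
    rewrite -xny; first by rewrite /x; congr nth; lia.
    by apply/mapP; exists k; rewrite ?mem_iota.
  exact: infix_trans (infix_take _ _) (infix_drop _ _).
exists 0.
have [n _ xny] := xy [seq 0 + k%:Z | k <- iota 0 (size m)] 0%N.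
apply: (@eq_from_nth _ a0); rewrite size_mkseq // => k km.
rewrite nth_mkseq // -xny; last by apply/mapP; exists k; rewrite ?mem_iota.
have [sn _ _] := st n.
rewrite /x /z (_ : absz _ = (n + k)%N); last by lia.
by rewrite nth_cat sn ltnNge leq_addr /= addKn nth_cat km.
Qed.

Theorem theorem5p5 (R : realType) (A : finType) (F : set (seq A))
  (hF : F `<=` @words A)
  (hc : exists c : R,
     [/\ c > #|A|%:R^-1,
         (\sum_(1 <= n <oo) ((num_words F n)%:R * c ^+ n)%:E
            < ((#|A|%:R * c - 1) / 2)%:E)%E
       & (\sum_(1 <= n <oo) (n%:R * (num_words F n)%:R * c `^ (n%:R / 3))%:E
            < (1 / 4)%:E)%E]) :
  forall v w : seq A, good_words F v -> good_words F w ->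
    language (subshift F) (v ++ w).
Proof.
move=> v w Gv Gw; have [c [cA sum1 sum2]] := hc.
have c0 : 0 < c by apply: le_lt_trans cA; rewrite invr_ge0.
apply: language_of_extensions.
  by have [[v0 _] _] := Gv; case: (v) v0.
apply: (@exists_admissible_extension R A F c) => //.
- exact: good_words_seam.
- move=> N; have pos n : 0 <= (num_words F n)%:R * c ^+ n by rewrite mulr_ge0 // exprn_ge0 // ltW.
  apply: ltW (lt_le_trans (nneseries_lt_partial pos sum1 N) _).
  (* The empty partial sum shows that |A| c - 1 is positive, so halving it only
     decreases it. *)
  have sum0 := nneseries_lt_partial pos sum1 1.
  by move: sum0; rewrite big_geq //; lra.
- move=> N; have pos n : 0 <= n%:R * (num_words F n)%:R * c `^ (n%:R / 3).
    by rewrite !mulr_ge0 ?powR_ge0.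
  by apply: lt_trans (nneseries_lt_partial pos sum2 N) _; lra.
Qed.
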